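(* Let $\mathcal{L}$ be a Lie algebra of a set-arrangement $\mathcal{A}$ on $X$. Suppose that $\mathcal{L}$ satisfies the replacement condition and that all two-element sets in $\mathcal{A}$ are (pairwise) disjoint. Suppose also that either (i) $\mathcal{L}$ is graded by giving the generators in $X$ some positive integer degrees, or (ii) for all $A\in\mathcal{A}$ there is at most one $B\in\mathcal{A}$ such that $|B|=2$ and $A\cap B\neq\emptyset$. Then the following conditions are equivalent: 1) $[x,\operatorname{im}(s_A')]=0$ for all $A\in\mathcal{A}$ and all $x\in X\setminus A$; 2) $\operatorname{im}(s_A')$ is an ideal in $\mathcal{L}$ for all $A\in\mathcal{A}$; 3) $\mathcal{L}'=\sum_{A\in\mathcal{A}}\operatorname{im}(s_A')$; 4) $s'$ is surjective; 5) $\pi'$ is injective; 6) $[x,[y,z]]=0$ in $\mathcal{L}$ for all $A\in\mathcal{A}$, all $y,z\in A$ and all $x\in X\setminus A$.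
   Context: Let $C$ be a commutative ring with unit. All Lie algebras are ordinary (non-super) Lie algebras over $C$; $\mathcal{F}(Y)$ denotes the free Lie algebra over $C$ on a set $Y$, and $\mathfrak{g}'=[\mathfrak{g},\mathfrak{g}]$ the derived Lie algebra. A set-arrangement on a finite set $X=\{x_1,\ldots,x_n\}$, $n\ge 2$, is a set $\mathcal{A}$ of subsets of $X$ such that each set in $\mathcal{A}$ has at least two elements, two different sets in $\mathcal{A}$ have at most one element in common, and the union of all the sets in $\mathcal{A}$ is $X$. A Lie algebra $\mathcal{L}$ of the set-arrangement $\mathcal{A}$ is a quotient of $\mathcal{F}(X)$ by the ideal generated by all $[x_i,x_j]$ such that $\{x_i,x_j\}$ is not a subset of any $A\in\mathcal{A}$, together with $R=\bigcup_{A\in\mathcal{A}}R_A$, where for each $A\in\mathcal{A}$, $R_A$ is a given subset of $\mathcal{F}(A)'=[\mathcal{F}(A),\mathcal{F}(A)]$. The localized Lie algebra at $A\in\mathcal{A}$ is $\mathcal{L}_A=\mathcal{F}(A)/\langle R_A\rangle$. For $A\in\mathcal{A}$, $s_A:\mathcal{L}_A\to\mathcal{L}$ is the natural Lie algebra morphism sending each generator in $A$ to itself, and $\pi_A:\mathcal{L}\to\mathcal{L}_A$ is the (well-defined) Lie algebra morphism sending all generators not in $A$ to zero and each generator in $A$ to itself. Their restrictions to derived algebras are $s_A':\mathcal{L}_A'\to\mathcal{L}'$ and $\pi_A':\mathcal{L}'\to\mathcal{L}_A'$. The $C$-module morphisms $s'$ and $\pi'$ are $$s'=\sum_{A\in\mathcal{A}}s_A':\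 \bigoplus_{A\in\mathcal{A}}\mathcal{L}_A'\to\mathcal{L}',\qquad \pi'=\bigoplus_{A\in\mathcal{A}}\pi_A':\ \mathcal{L}'\to\bigoplus_{A\in\mathcal{A}}\mathcal{L}_A'.$$ $\mathcal{L}$ satisfies the replacement condition if for all $A\in\mathcal{A}$ with $|A|\ge 3$ and all $x\in A$ such that $x\in B$ for some $B\in\mathcal{A}$ with $B\neq A$, the derived algebra $\mathcal{L}_A'$ is contained in the Lie subalgebra of $\mathcal{L}_A$ generated by $A\setminus\{x\}$. Condition (i) means that for some assignment of positive integer degrees to the elements of $X$, the induced grading of $\mathcal{F}(X)$ descends to a grading of $\mathcal{L}$ (i.e. the defining ideal of $\mathcal{L}$ is homogeneous). *)

(* Defs.v *)
From HB Require Import structures.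
From mathcomp Require Import all_boot all_order all_algebra.
From mathcomp Require Import generic_quotient.
From mathcomp Require Import boolp classical_sets.

Set Implicit Arguments.
Unset Strict Implicit.
Unset Printing Implicit Defensive.

Import GRing.Theory.

Local Open Scope quotient_scope.
Local Open Scope classical_set_scope.
Local Open Scope ring_scope.

(* comPzRingType is the type of all commutative unital rings, including the   *)
(* zero ring.                                                                 *)
HB.mixin Record Lmodule_isLieAlgebra (C : comPzRingType) L
    of GRing.Lmodule C L := {
  lie_bracket : L -> L -> L;
  lie_linearl : forall (a : C) (x y z : L),
    lie_bracket (a *: x + y) z = a *: lie_bracket x z + lie_bracket y z;
  lie_linearr : forall (a : C) (x y z : L),
    lie_bracket z (a *: x + y) = a *: lie_bracket z x + lie_bracket z y;
  lie_alt : forall x : L, lie_bracket x x = 0;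
  lie_jacobi : forall x y z : L,
    lie_bracket x (lie_bracket y z) + lie_bracket y (lie_bracket z x)
      + lie_bracket z (lie_bracket x y) = 0
}.

#[short(type="lieAlgType")]
HB.structure Definition LieAlgebra (C : comPzRingType) :=
  {L of Lmodule_isLieAlgebra C L & GRing.Lmodule C L}.

Notation "[ 'lie' x , y ]" := (lie_bracket x y)
  (at level 0, x, y at level 99, format "[ 'lie'  x ,  y ]") : ring_scope.

HB.mixin Record isLieMorphism (C : comPzRingType) (L M : lieAlgType C)
    (f : L -> M) := {
  lie_morphism_subproof : forall x y : L, f [lie x, y] = [lie f x, f y]
}.

HB.structure Definition LieMorphism (C : comPzRingType) (L M : lieAlgType C) :=
  {f of isLieMorphism C L M f & @GRing.Linear C L M *:%R f}.

Notation "{ 'liemorphism' L -> M }" := (@LieMorphism.type _ L M)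
  (at level 0, L at level 98, M at level 99,
   format "{ 'liemorphism'  L  ->  M }") : type_scope.

Section LieTheory.
Variables (C : comPzRingType).
Implicit Types L M : lieAlgType C.

Lemma lieDl L (x y z : L) : [lie x + y, z] = [lie x, z] + [lie y, z].
Proof. by have := lie_linearl 1 x y z; rewrite !scale1r. Qed.

Lemma lieDr L (x y z : L) : [lie z, x + y] = [lie z, x] + [lie z, y].
Proof. by have := lie_linearr 1 x y z; rewrite !scale1r. Qed.

Lemma lie0l L (z : L) : [lie 0, z] = 0.
Proof. by apply: (addrI [lie 0, z]); rewrite -lieDl !addr0. Qed.

Lemma lie0r L (z : L) : [lie z, 0] = 0.
Proof. by apply: (addrI [lie z, 0]); rewrite -lieDr !addr0. Qed.

Lemma lieZl L a (x z : L) : [lie a *: x, z] = a *: [lie x, z].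
Proof. by have := lie_linearl a x 0 z; rewrite lie0l !addr0. Qed.

Lemma lieZr L a (x z : L) : [lie z, a *: x] = a *: [lie z, x].
Proof. by have := lie_linearr a x 0 z; rewrite lie0r !addr0. Qed.

Lemma lieNl L (x z : L) : [lie - x, z] = - [lie x, z].
Proof. by rewrite -scaleN1r lieZl scaleN1r. Qed.

Lemma lieNr L (x z : L) : [lie z, - x] = - [lie z, x].
Proof. by rewrite -scaleN1r lieZr scaleN1r. Qed.

Lemma lieBl L (x y z : L) : [lie x - y, z] = [lie x, z] - [lie y, z].
Proof. by rewrite lieDl lieNl. Qed.

Lemma lieBr L (x y z : L) : [lie z, x - y] = [lie z, x] - [lie z, y].
Proof. by rewrite lieDr lieNr. Qed.

Lemma lieC L (x y : L) : [lie x, y] = - [lie y, x].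
Proof.
have := lie_alt (x + y); rewrite lieDl !lieDr !lie_alt addr0 add0r => h.
by apply/eqP; rewrite -addr_eq0; apply/eqP.
Qed.

Lemma lie_morph L M (f : {liemorphism L -> M}) (x y : L) :
  f [lie x, y] = [lie f x, f y].
Proof. exact: lie_morphism_subproof. Qed.

Lemma lie_morphP L M (f : {liemorphism L -> M}) a (x y : L) :
  f (a *: x + y) = a *: f x + f y.
Proof. exact: linearP. Qed.

Lemma lie_morph0 L M (f : {liemorphism L -> M}) : f 0 = 0.
Proof. exact: linear0. Qed.

End LieTheory.

Section Subobjects.
Variables (C : comPzRingType) (L : lieAlgType C).
Implicit Types S H : set L.

Definition is_submodule H : Prop :=
  H 0 /\ forall (a : C) x y, H x -> H y -> H (a *: x + y).

Definition is_lie_subalgebra H : Prop :=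
  is_submodule H /\ forall x y, H x -> H y -> H [lie x, y].

Definition is_lie_ideal H : Prop :=
  is_submodule H /\ forall x y, H y -> H [lie x, y].

Definition lie_subalgebra_gen S : set L := smallest is_lie_subalgebra S.

Definition derived_set : set L :=
  smallest is_submodule [set z | exists x y : L, z = [lie x, y]].

Record lieIdeal := LieIdeal {
  lie_ideal_set :> set L;
  lie_idealP : is_lie_ideal lie_ideal_set }.

Lemma is_lie_ideal_smallest S : is_lie_ideal (smallest is_lie_ideal S).
Proof.
split; [split|].
- by move=> H [[[]]].
- move=> a x y hx hy H HH; have [[[_ hl] _] _] := HH.
  by apply: hl; [exact: hx | exact: hy].
- by move=> x y hy H HH; have [[_ hl] _] := HH; apply: hl; exact: hy.
Qed.

Definition lie_ideal_gen S : lieIdeal := LieIdeal (is_lie_ideal_smallest S).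

Lemma sub_lie_ideal_gen S : S `<=` lie_ideal_gen S.
Proof. by move=> x Sx H [_]; apply. Qed.

Lemma lie_ideal_gen_min S H : is_lie_ideal H -> S `<=` H -> lie_ideal_gen S `<=` H.
Proof. by move=> hH SH x; apply. Qed.

Lemma derived_set_submodule : is_submodule derived_set.
Proof.
split=> [H [[]]|a x y hx hy H HH] //; have [[_ hl] _] := HH.
by apply: hl; [exact: hx | exact: hy].
Qed.

Lemma lie_derived x y : derived_set [lie x, y].
Proof. by move=> H [_]; apply; exists x, y. Qed.

Definition derived_pred : {pred L} := fun x => `[< derived_set x >].

Lemma derived_submod_closed : submod_closed derived_pred.
Proof.
have [h0 hl] := derived_set_submodule.
split; first exact/asboolP.
by move=> a x y /asboolP hx /asboolP hy; apply/asboolP; exact: hl.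
Qed.

HB.instance Definition _ :=
  GRing.isSubmodClosed.Build C L derived_pred derived_submod_closed.

Record derived := Derived {
  derived_val :> L;
  derived_valP : derived_val \in derived_pred }.

HB.instance Definition _ := [isSub for derived_val].
HB.instance Definition _ := [Choice of derived by <:].
HB.instance Definition _ := [SubChoice_isSubLmodule of derived by <:].

End Subobjects.

Section DerivedMap.
Variables (C : comPzRingType) (L M : lieAlgType C) (f : {liemorphism L -> M}).

Lemma derived_set_morph x : derived_set x -> derived_set (f x).
Proof.
move=> h; apply: (h [set x | derived_set (f x)]); split.
- have [h0 hl] := derived_set_submodule M.
  split=> [|a u v hu hv] /=; first by rewrite linear0.
  by rewrite linearP; exact: hl.
- by move=> _ [u [v ->]] /=; rewrite lie_morph; exact: lie_derived.
Qed.

Lemma derived_map_subproof (u : derived L) : f (val u) \in @derived_pred C M.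
Proof.
by case: u => x /= /asboolP hx; apply/asboolP; exact: derived_set_morph.
Qed.

Definition derived_map (u : derived L) : derived M :=
  Derived (derived_map_subproof u).

Lemma derived_map_linear : linear derived_map.
Proof. by move=> a u v; apply: val_inj; rewrite /= !linearP. Qed.

HB.instance Definition _ :=
  GRing.isLinear.Build C (derived L) (derived M) *:%R derived_map
    derived_map_linear.

End DerivedMap.

Section Quotient.
Variables (C : comPzRingType) (L : lieAlgType C) (I : lieIdeal L).

Definition lie_quot_rel (x y : L) : bool := `[< lie_ideal_set I (x - y) >].

Let I0 : lie_ideal_set I 0. Proof. by case: (lie_idealP I) => -[]. Qed.
Let ID a x y : lie_ideal_set I x -> lie_ideal_set I y ->
  lie_ideal_set I (a *: x + y).
Proof. by case: (lie_idealP I) => -[_ h] _; exact: h. Qed.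
Let IB x y : lie_ideal_set I y -> lie_ideal_set I [lie x, y].
Proof. by case: (lie_idealP I) => _; apply. Qed.
Let IA x y : lie_ideal_set I x -> lie_ideal_set I y -> lie_ideal_set I (x + y).
Proof. by move=> hx hy; rewrite -[x]scale1r; exact: ID. Qed.
Let IN x : lie_ideal_set I x -> lie_ideal_set I (- x).
Proof. by move=> hx; rewrite -[- x]addr0 -scaleN1r; exact: ID. Qed.

Lemma lie_quot_rel_equiv : equiv_class_of lie_quot_rel.
Proof.
split=> [x|x y|y x z].
- by apply/asboolP; rewrite subrr.
- by apply/asboolP/asboolP => h; rewrite -opprB; exact: IN.
- move=> /asboolP hxy /asboolP hyz; apply/asboolP.
  by rewrite -[x](subrK y) -addrA; exact: IA.
Qed.

Canonical lie_quot_equiv := EquivRelPack lie_quot_rel_equiv.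

Definition lie_quot := {eq_quot lie_quot_equiv}.

HB.instance Definition _ := Choice.on lie_quot.
HB.instance Definition _ := EqQuotient.on lie_quot.

Definition lie_quot_pi (x : L) : lie_quot := \pi_lie_quot x.

Lemma lie_quot_piP x y :
  lie_quot_pi x = lie_quot_pi y <-> lie_ideal_set I (x - y).
Proof. by split=> [/eqmodP/asboolP|h] //; apply/eqmodP/asboolP. Qed.

Lemma lie_quot_ind (P : lie_quot -> Prop) :
  (forall x, P (lie_quot_pi x)) -> forall q, P q.
Proof. by move=> h q; rewrite -[q]reprK; exact: h. Qed.

Let repr_pi x : lie_ideal_set I (repr (lie_quot_pi x) - x).
Proof. by apply/lie_quot_piP; rewrite /lie_quot_pi reprK. Qed.

Definition lie_quot_add (p q : lie_quot) := lie_quot_pi (repr p + repr q).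
Definition lie_quot_opp (p : lie_quot) := lie_quot_pi (- repr p).
Definition lie_quot_scale (a : C) (p : lie_quot) := lie_quot_pi (a *: repr p).
Definition lie_quot_bracket (p q : lie_quot) := lie_quot_pi [lie repr p, repr q].

Let addE x y :
  lie_quot_add (lie_quot_pi x) (lie_quot_pi y) = lie_quot_pi (x + y).
Proof. by apply/lie_quot_piP; rewrite opprD addrACA; exact: IA. Qed.
Let oppE x : lie_quot_opp (lie_quot_pi x) = lie_quot_pi (- x).
Proof. by apply/lie_quot_piP; rewrite -opprD; exact: IN. Qed.
Let scaleE a x : lie_quot_scale a (lie_quot_pi x) = lie_quot_pi (a *: x).
Proof.
by apply/lie_quot_piP; rewrite -scalerBr -[X in lie_ideal_set I X]addr0; exact: ID.
Qed.
Let bracketE x y :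
  lie_quot_bracket (lie_quot_pi x) (lie_quot_pi y) = lie_quot_pi [lie x, y].
Proof.
apply/lie_quot_piP; have := repr_pi x; have := repr_pi y.
move: (repr (lie_quot_pi x)) (repr (lie_quot_pi y)) => x' y' hy hx.
rewrite -[X in X - _](subrK [lie x', y]) -addrA -lieBr -lieBl.
by apply: IA; [exact: IB | rewrite lieC; apply: IN; exact: IB].
Qed.

Let addA : associative lie_quot_add.
Proof.
by elim/lie_quot_ind=> x; elim/lie_quot_ind=> y; elim/lie_quot_ind=> z;
  rewrite !addE addrA.
Qed.
Let addC : commutative lie_quot_add.
Proof. by elim/lie_quot_ind=> x; elim/lie_quot_ind=> y; rewrite !addE addrC. Qed.
Let add0 : left_id (lie_quot_pi 0) lie_quot_add.
Proof. by elim/lie_quot_ind=> x; rewrite addE add0r. Qed.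
Let addN : left_inverse (lie_quot_pi 0) lie_quot_opp lie_quot_add.
Proof. by elim/lie_quot_ind=> x; rewrite oppE addE addNr. Qed.

HB.instance Definition _ :=
  GRing.isZmodule.Build lie_quot addA addC add0 addN.

Let piD x y : lie_quot_pi x + lie_quot_pi y = lie_quot_pi (x + y).
Proof. exact: addE. Qed.

Let scaleA a b q :
  lie_quot_scale a (lie_quot_scale b q) = lie_quot_scale (a * b) q.
Proof. by elim/lie_quot_ind: q => x; rewrite !scaleE scalerA. Qed.
Let scale1 : left_id 1 lie_quot_scale.
Proof. by elim/lie_quot_ind=> x; rewrite scaleE scale1r. Qed.
Let scaleDr : right_distributive lie_quot_scale +%R.
Proof.
move=> a; elim/lie_quot_ind=> x; elim/lie_quot_ind=> y.
by rewrite piD !scaleE piD scalerDr.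
Qed.
Let scaleDl q : {morph lie_quot_scale^~ q : a b / a + b}.
Proof.
by move=> a b; elim/lie_quot_ind: q => x; rewrite !scaleE piD scalerDl.
Qed.

HB.instance Definition _ := GRing.Zmodule_isLmodule.Build C lie_quot
  scaleA scale1 scaleDr scaleDl.

Let piZ a x : a *: lie_quot_pi x = lie_quot_pi (a *: x).
Proof. exact: scaleE. Qed.

Lemma lie_quot_pi_linear : linear lie_quot_pi.
Proof. by move=> a x y; rewrite piZ piD. Qed.

HB.instance Definition _ :=
  GRing.isLinear.Build C L lie_quot *:%R lie_quot_pi lie_quot_pi_linear.

Let bracketl a x y z : lie_quot_bracket (a *: x + y) z =
  a *: lie_quot_bracket x z + lie_quot_bracket y z.
Proof.
elim/lie_quot_ind: x => x; elim/lie_quot_ind: y => y; elim/lie_quot_ind: z => z.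
by rewrite -linearP !bracketE -linearP lie_linearl.
Qed.
Let bracketr a x y z : lie_quot_bracket z (a *: x + y) =
  a *: lie_quot_bracket z x + lie_quot_bracket z y.
Proof.
elim/lie_quot_ind: x => x; elim/lie_quot_ind: y => y; elim/lie_quot_ind: z => z.
by rewrite -linearP !bracketE -linearP lie_linearr.
Qed.
Let bracket_alt x : lie_quot_bracket x x = 0.
Proof. by elim/lie_quot_ind: x => x; rewrite bracketE lie_alt linear0. Qed.
Let bracket_jacobi x y z :
  lie_quot_bracket x (lie_quot_bracket y z)
  + lie_quot_bracket y (lie_quot_bracket z x)
  + lie_quot_bracket z (lie_quot_bracket x y) = 0.
Proof.
elim/lie_quot_ind: x => x; elim/lie_quot_ind: y => y; elim/lie_quot_ind: z => z.
by rewrite !bracketE !piD lie_jacobi linear0.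
Qed.

HB.instance Definition _ := Lmodule_isLieAlgebra.Build C lie_quot
  bracketl bracketr bracket_alt bracket_jacobi.

Lemma lie_quot_pi_morph x y :
  lie_quot_pi [lie x, y] = [lie lie_quot_pi x, lie_quot_pi y].
Proof. by rewrite [RHS]bracketE. Qed.

HB.instance Definition _ :=
  isLieMorphism.Build C L lie_quot lie_quot_pi lie_quot_pi_morph.

Lemma lie_quot_pi_eq0 x : lie_quot_pi x = 0 <-> lie_ideal_set I x.
Proof. by rewrite -(linear0 lie_quot_pi) lie_quot_piP subr0. Qed.

Section Lift.
Variables (M : lieAlgType C) (f : {liemorphism L -> M}).
Hypothesis f0 : forall x, lie_ideal_set I x -> f x = 0.

Definition lie_quot_lift (_ : forall x, lie_ideal_set I x -> f x = 0)
    (q : lie_quot) : M := f (repr q).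

Local Notation lift := (lie_quot_lift f0).

Lemma lie_quot_lift_pi x : lift (lie_quot_pi x) = f x.
Proof. by apply/eqP; rewrite -subr_eq0 -linearB; apply/eqP/f0. Qed.

Lemma lie_quot_lift_linear : linear lift.
Proof.
move=> a; elim/lie_quot_ind=> x; elim/lie_quot_ind=> y.
by rewrite -linearP !lie_quot_lift_pi linearP.
Qed.

HB.instance Definition _ :=
  GRing.isLinear.Build C lie_quot M *:%R lift lie_quot_lift_linear.

Lemma lie_quot_lift_morph x y : lift [lie x, y] = [lie lift x, lift y].
Proof.
elim/lie_quot_ind: x => x; elim/lie_quot_ind: y => y.
by rewrite -lie_quot_pi_morph !lie_quot_lift_pi lie_morph.
Qed.

HB.instance Definition _ :=
  isLieMorphism.Build C lie_quot M lift lie_quot_lift_morph.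

End Lift.

End Quotient.

(* It is the quotient of the formal Lie expressions in the generators by the  *)
(* least congruence containing the axioms of a Lie algebra over C; its        *)
(* universal property is given by free_lie_lift, free_lie_lift_gen and        *)
(* free_lie_lift_unique.                                                      *)
Inductive lie_term (C Y : Type) : Type :=
  | LGen of Y
  | LZero
  | LOpp of lie_term C Y
  | LAdd of lie_term C Y & lie_term C Y
  | LScale of C & lie_term C Y
  | LBr of lie_term C Y & lie_term C Y.

Arguments LGen {C Y}.
Arguments LZero {C Y}.

HB.instance Definition _ C Y := gen_eqMixin (lie_term C Y).
HB.instance Definition _ C Y := gen_choiceMixin (lie_term C Y).

Section FreeLie.
Variables (C : comPzRingType) (Y : Type).
Local Notation term := (lie_term C Y).
Implicit Types t u v w : term.

Inductive lie_term_eq : term -> term -> Prop :=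
  | LE_refl t : lie_term_eq t t
  | LE_sym t u : lie_term_eq t u -> lie_term_eq u t
  | LE_trans t u v : lie_term_eq t u -> lie_term_eq u v -> lie_term_eq t v
  | LE_opp t u : lie_term_eq t u -> lie_term_eq (LOpp t) (LOpp u)
  | LE_add t u v w : lie_term_eq t u -> lie_term_eq v w ->
      lie_term_eq (LAdd t v) (LAdd u w)
  | LE_scale a t u : lie_term_eq t u -> lie_term_eq (LScale a t) (LScale a u)
  | LE_br t u v w : lie_term_eq t u -> lie_term_eq v w ->
      lie_term_eq (LBr t v) (LBr u w)
  | LE_addA t u v : lie_term_eq (LAdd t (LAdd u v)) (LAdd (LAdd t u) v)
  | LE_addC t u : lie_term_eq (LAdd t u) (LAdd u t)
  | LE_add0 t : lie_term_eq (LAdd LZero t) t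
  | LE_addN t : lie_term_eq (LAdd (LOpp t) t) LZero
  | LE_scaleA a b t : lie_term_eq (LScale a (LScale b t)) (LScale (a * b) t)
  | LE_scale1 t : lie_term_eq (LScale 1 t) t
  | LE_scaleDr a t u :
      lie_term_eq (LScale a (LAdd t u)) (LAdd (LScale a t) (LScale a u))
  | LE_scaleDl a b t :
      lie_term_eq (LScale (a + b) t) (LAdd (LScale a t) (LScale b t))
  | LE_brl a t u v : lie_term_eq
      (LBr (LAdd (LScale a t) u) v) (LAdd (LScale a (LBr t v)) (LBr u v))
  | LE_brr a t u v : lie_term_eq
      (LBr v (LAdd (LScale a t) u)) (LAdd (LScale a (LBr v t)) (LBr v u))
  | LE_alt t : lie_term_eq (LBr t t) LZero
  | LE_jacobi t u v : lie_term_eq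
      (LAdd (LAdd (LBr t (LBr u v)) (LBr u (LBr v t))) (LBr v (LBr t u))) LZero.

Definition lie_term_eqb t u : bool := `[< lie_term_eq t u >].

Lemma lie_term_eqb_equiv : equiv_class_of lie_term_eqb.
Proof.
split=> [t|t u|u t v].
- by apply/asboolP; exact: LE_refl.
- by apply/asboolP/asboolP; exact: LE_sym.
- by move=> /asboolP h1 /asboolP h2; apply/asboolP; exact: LE_trans h1 h2.
Qed.

Canonical lie_term_equiv := EquivRelPack lie_term_eqb_equiv.

Definition free_lie := {eq_quot lie_term_equiv}.

HB.instance Definition _ := Choice.on free_lie.
HB.instance Definition _ := EqQuotient.on free_lie.

Let cl (t : term) : free_lie := \pi_free_lie t.

Let clP t u : cl t = cl u <-> lie_term_eq t u.
Proof. by split=> [/eqmodP/asboolP|h] //; apply/eqmodP/asboolP. Qed.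

Let cl_ind (P : free_lie -> Prop) : (forall t, P (cl t)) -> forall q, P q.
Proof. by move=> h q; rewrite -[q]reprK; exact: h. Qed.

Let repr_cl t : lie_term_eq (repr (cl t)) t.
Proof. by apply/clP; rewrite /cl reprK. Qed.

Definition free_lie_add (p q : free_lie) : free_lie :=
  \pi_free_lie (LAdd (repr p) (repr q)).
Definition free_lie_opp (p : free_lie) : free_lie :=
  \pi_free_lie (LOpp (repr p)).
Definition free_lie_scale (a : C) (p : free_lie) : free_lie :=
  \pi_free_lie (LScale a (repr p)).
Definition free_lie_bracket (p q : free_lie) : free_lie :=
  \pi_free_lie (LBr (repr p) (repr q)).

Let addE t u : free_lie_add (cl t) (cl u) = cl (LAdd t u).
Proof. by apply/clP; apply: LE_add. Qed.
Let oppE t : free_lie_opp (cl t) = cl (LOpp t).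
Proof. by apply/clP; apply: LE_opp. Qed.
Let scaleE a t : free_lie_scale a (cl t) = cl (LScale a t).
Proof. by apply/clP; apply: LE_scale. Qed.
Let bracketE t u : free_lie_bracket (cl t) (cl u) = cl (LBr t u).
Proof. by apply/clP; apply: LE_br. Qed.

Let addA : associative free_lie_add.
Proof.
elim/cl_ind=> t; elim/cl_ind=> u; elim/cl_ind=> v.
by rewrite !addE; apply/clP; exact: LE_addA.
Qed.
Let addC : commutative free_lie_add.
Proof.
by elim/cl_ind=> t; elim/cl_ind=> u; rewrite !addE; apply/clP; exact: LE_addC.
Qed.
Let add0 : left_id (cl LZero) free_lie_add.
Proof. by elim/cl_ind=> t; rewrite addE; apply/clP; exact: LE_add0. Qed.
Let addN : left_inverse (cl LZero) free_lie_opp free_lie_add.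
Proof. by elim/cl_ind=> t; rewrite oppE addE; apply/clP; exact: LE_addN. Qed.

HB.instance Definition _ :=
  GRing.isZmodule.Build free_lie addA addC add0 addN.

Let clD t u : cl t + cl u = cl (LAdd t u).
Proof. exact: addE. Qed.

Let scaleA a b q :
  free_lie_scale a (free_lie_scale b q) = free_lie_scale (a * b) q.
Proof. by elim/cl_ind: q => t; rewrite !scaleE; apply/clP; exact: LE_scaleA. Qed.
Let scale1 : left_id 1 free_lie_scale.
Proof. by elim/cl_ind=> t; rewrite scaleE; apply/clP; exact: LE_scale1. Qed.
Let scaleDr : right_distributive free_lie_scale +%R.
Proof.
move=> a; elim/cl_ind=> t; elim/cl_ind=> u.
by rewrite clD !scaleE clD; apply/clP; exact: LE_scaleDr.
Qed.
Let scaleDl q : {morph free_lie_scale^~ q : a b / a + b}.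
Proof.
move=> a b; elim/cl_ind: q => t.
by rewrite !scaleE clD; apply/clP; exact: LE_scaleDl.
Qed.

HB.instance Definition _ := GRing.Zmodule_isLmodule.Build C free_lie
  scaleA scale1 scaleDr scaleDl.

Let clZ a t : a *: cl t = cl (LScale a t).
Proof. exact: scaleE. Qed.

Let lincE a t u : a *: cl t + cl u = cl (LAdd (LScale a t) u).
Proof. by rewrite clZ clD. Qed.

Let bracketl a x y z : free_lie_bracket (a *: x + y) z =
  a *: free_lie_bracket x z + free_lie_bracket y z.
Proof.
elim/cl_ind: x => x; elim/cl_ind: y => y; elim/cl_ind: z => z.
by rewrite lincE !bracketE lincE; apply/clP; exact: LE_brl.
Qed.
Let bracketr a x y z : free_lie_bracket z (a *: x + y) =
  a *: free_lie_bracket z x + free_lie_bracket z y.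
Proof.
elim/cl_ind: x => x; elim/cl_ind: y => y; elim/cl_ind: z => z.
by rewrite lincE !bracketE lincE; apply/clP; exact: LE_brr.
Qed.
Let bracket_alt x : free_lie_bracket x x = 0.
Proof. by elim/cl_ind: x => x; rewrite bracketE; apply/clP; exact: LE_alt. Qed.
Let bracket_jacobi x y z :
  free_lie_bracket x (free_lie_bracket y z)
  + free_lie_bracket y (free_lie_bracket z x)
  + free_lie_bracket z (free_lie_bracket x y) = 0.
Proof.
elim/cl_ind: x => x; elim/cl_ind: y => y; elim/cl_ind: z => z.
rewrite !bracketE !clD.
by apply/clP; exact: LE_jacobi.
Qed.

HB.instance Definition _ := Lmodule_isLieAlgebra.Build C free_lie
  bracketl bracketr bracket_alt bracket_jacobi.

Definition free_lie_gen (y : Y) : free_lie := \pi_free_lie (LGen y).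

Lemma free_lie_ind (P : free_lie -> Prop) :
  (forall y, P (free_lie_gen y)) -> P 0 ->
  (forall a x y, P x -> P y -> P (a *: x + y)) ->
  (forall x y, P x -> P y -> P [lie x, y]) -> forall x, P x.
Proof.
move=> hg h0 hl hb; elim/cl_ind; elim=> [y||t ht|t ht u hu|a t ht|t ht u hu].
- exact: hg.
- exact: h0.
- have -> : cl (LOpp t) = -1 *: cl t + 0.
    by rewrite addr0 scaleN1r [RHS]oppE.
  exact: hl.
- have -> : cl (LAdd t u) = 1 *: cl t + cl u.
    by rewrite scale1r clD.
  exact: hl.
- have -> : cl (LScale a t) = a *: cl t + 0.
    by rewrite addr0 clZ.
  exact: hl.
- have -> : cl (LBr t u) = [lie cl t, cl u] by rewrite [RHS]bracketE.
  exact: hb.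
Qed.

Section Lift.
Variables (M : lieAlgType C) (f : Y -> M).

Fixpoint lie_term_eval t : M :=
  match t with
  | LGen y => f y
  | LZero => 0
  | LOpp t => - lie_term_eval t
  | LAdd t u => lie_term_eval t + lie_term_eval u
  | LScale a t => a *: lie_term_eval t
  | LBr t u => [lie lie_term_eval t, lie_term_eval u]
  end.

Lemma lie_term_eval_eq t u :
  lie_term_eq t u -> lie_term_eval t = lie_term_eval u.
Proof.
elim=> //= {t u}.
- by move=> t u v _ -> _ ->.
- by move=> t u _ ->.
- by move=> t u v w _ -> _ ->.
- by move=> a t u _ ->.
- by move=> t u v w _ -> _ ->.
- by move=> *; rewrite addrA.
- by move=> *; rewrite addrC.
- by move=> *; rewrite add0r.
- by move=> *; rewrite addNr.
- by move=> *; rewrite scalerA.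
- by move=> *; rewrite scale1r.
- by move=> *; rewrite scalerDr.
- by move=> *; rewrite scalerDl.
- by move=> *; rewrite lie_linearl.
- by move=> *; rewrite lie_linearr.
- by move=> *; rewrite lie_alt.
- by move=> *; rewrite lie_jacobi.
Qed.

Definition free_lie_lift (x : free_lie) : M := lie_term_eval (repr x).

Let lift_cl t : free_lie_lift (cl t) = lie_term_eval t.
Proof. exact: lie_term_eval_eq. Qed.

Lemma free_lie_lift_gen y : free_lie_lift (free_lie_gen y) = f y.
Proof. exact: lift_cl. Qed.

Lemma free_lie_lift_linear : linear free_lie_lift.
Proof.
by move=> a; elim/cl_ind=> t; elim/cl_ind=> u; rewrite lincE !lift_cl.
Qed.

HB.instance Definition _ :=
  GRing.isLinear.Build C free_lie M *:%R free_lie_lift free_lie_lift_linear.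

Lemma free_lie_lift_morph x y :
  free_lie_lift [lie x, y] = [lie free_lie_lift x, free_lie_lift y].
Proof.
elim/cl_ind: x => t; elim/cl_ind: y => u.
by rewrite [X in free_lie_lift X]bracketE !lift_cl.
Qed.

HB.instance Definition _ :=
  isLieMorphism.Build C free_lie M free_lie_lift free_lie_lift_morph.

Lemma free_lie_lift_unique (g : {liemorphism free_lie -> M}) :
  (forall y, g (free_lie_gen y) = f y) -> g =1 free_lie_lift.
Proof.
move=> hg; elim/free_lie_ind=> [y||a x y hx hy|x y hx hy].
- by rewrite hg free_lie_lift_gen.
- by rewrite !lie_morph0.
- by rewrite !lie_morphP hx hy.
- by rewrite lie_morph hx hy free_lie_lift_morph.
Qed.

End Lift.

(* The homogeneous component of degree d for the grading with generator y in  *)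
(* degree deg y.                                                              *)
Inductive free_lie_homog (deg : Y -> nat) : nat -> set free_lie :=
  | Homog_gen y : free_lie_homog deg (deg y) (free_lie_gen y)
  | Homog_zero d : free_lie_homog deg d 0
  | Homog_linear d (a : C) x y :
      free_lie_homog deg d x -> free_lie_homog deg d y ->
      free_lie_homog deg d (a *: x + y)
  | Homog_bracket d e x y :
      free_lie_homog deg d x -> free_lie_homog deg e y ->
      free_lie_homog deg (d + e)%N [lie x, y].

(* I is the sum of its intersections with the homogeneous components. *)
Definition homogeneous_ideal (deg : Y -> nat) (I : lieIdeal free_lie) : Prop :=
  forall u : free_lie, lie_ideal_set I u ->
    exists (n : nat) (c : nat -> free_lie),
      (forall d, free_lie_homog deg d (c d) /\ lie_ideal_set I (c d))
      /\ u = \sum_(d < n) c d.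

End FreeLie.

Arguments free_lie_gen {C Y}.

Section DirectSum.
Variables (C : comPzRingType) (I : finType) (V : I -> lmodType C).

Definition direct_sum := {dffun forall i : I, V i}.

HB.instance Definition _ := Choice.on direct_sum.

Implicit Types u v w : direct_sum.

Definition direct_sum_of (u : forall i, V i) : direct_sum := finfun u.

Let zero : direct_sum := direct_sum_of (fun i => 0).
Let opp u : direct_sum := direct_sum_of (fun i => - u i).
Let add u v : direct_sum := direct_sum_of (fun i => u i + v i).
Let scale (a : C) u : direct_sum := direct_sum_of (fun i => a *: u i).

Let addA : associative add.
Proof. by move=> u v w; apply/ffunP=> i; rewrite !ffunE addrA. Qed.
Let addC : commutative add.
Proof. by move=> u v; apply/ffunP=> i; rewrite !ffunE addrC. Qed.
Let add0 : left_id zero add.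
Proof. by move=> u; apply/ffunP=> i; rewrite !ffunE add0r. Qed.
Let addN : left_inverse zero opp add.
Proof. by move=> u; apply/ffunP=> i; rewrite !ffunE addNr. Qed.

HB.instance Definition _ := GRing.isZmodule.Build direct_sum addA addC add0 addN.

Let scaleA a b u : scale a (scale b u) = scale (a * b) u.
Proof. by apply/ffunP=> i; rewrite !ffunE scalerA. Qed.
Let scale1 : left_id 1 scale.
Proof. by move=> u; apply/ffunP=> i; rewrite !ffunE scale1r. Qed.
Let scaleDr : right_distributive scale +%R.
Proof. by move=> a u v; apply/ffunP=> i; rewrite !ffunE scalerDr. Qed.
Let scaleDl u : {morph scale^~ u : a b / a + b}.
Proof. by move=> a b; apply/ffunP=> i; rewrite !ffunE scalerDl. Qed.

HB.instance Definition _ := GRing.Zmodule_isLmodule.Build C direct_sum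
  scaleA scale1 scaleDr scaleDl.

Lemma direct_sum_linE a u v i : (a *: u + v) i = a *: u i + v i.
Proof. by rewrite !ffunE. Qed.

End DirectSum.

Record set_arrangement (X : finType) := SetArrangement {
  blocks : {set {set X}};
  arr_ground_card : (2 <= #|X|)%N;
  arr_block_card : forall A, A \in blocks -> (2 <= #|A|)%N;
  arr_block_meet : forall A B,
    A \in blocks -> B \in blocks -> A != B -> (#|A :&: B| <= 1)%N;
  arr_cover : finset.cover blocks = [set: X]%SET }.

Definition block (X : finType) (A : set_arrangement X) :=
  {B : {set X} | B \in blocks A}.

Definition block_elt (X : finType) (A : set_arrangement X) (B : block A) :=
  {x : X | x \in val B}.

(* The data (R_B) defining a Lie algebra of the arrangement: relators in the  *)
(* derived algebra of the free Lie algebra on each block.                     *)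
Record relators (C : comPzRingType) (X : finType) (A : set_arrangement X) :=
  Relators {
    relator_set : forall B : block A, set (free_lie C (block_elt B));
    relator_derived : forall B, @relator_set B `<=` @derived_set C _ }.

Arguments relator_set {C X A} _ B _.

Section ArrangementLie.
Variables (C : comPzRingType) (X : finType) (A : set_arrangement X).
Variable (R : relators C A).
Implicit Types B : block A.

Definition free_incl B : free_lie C (block_elt B) -> free_lie C X :=
  free_lie_lift (fun x => free_lie_gen (val x)).

HB.instance Definition _ B := LieMorphism.on (@free_incl B).

Definition arr_commutators : set (free_lie C X) :=
  [set u | exists x y : X,
    (forall D, D \in blocks A -> ~~ ([set x; y]%SET \subset D))
    /\ u = [lie free_lie_gen x, free_lie_gen y]].

Definition arr_relators : set (free_lie C X) :=
  [set u | exists B, exists2 r, relator_set R B r & u = free_incl r].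

Definition arr_ideal : lieIdeal (free_lie C X) :=
  lie_ideal_gen (arr_commutators `|` arr_relators).

Definition arr_lie : lieAlgType C := lie_quot arr_ideal.

Definition arr_gen (x : X) : arr_lie := lie_quot_pi arr_ideal (free_lie_gen x).

Definition loc_ideal B : lieIdeal (free_lie C (block_elt B)) :=
  lie_ideal_gen (relator_set R B).

Definition loc_lie B : lieAlgType C := lie_quot (loc_ideal B).

Definition loc_gen B (x : block_elt B) : loc_lie B :=
  lie_quot_pi (loc_ideal B) (free_lie_gen x).

(* loc_s B is s_B, induced on the quotient by free_to_arr B. *)
Definition free_to_arr B : free_lie C (block_elt B) -> arr_lie :=
  free_lie_lift (fun x => arr_gen (val x)).

HB.instance Definition _ B := LieMorphism.on (@free_to_arr B).

Lemma ker_ideal (L M : lieAlgType C) (f : {liemorphism L -> M}) :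
  is_lie_ideal [set x | f x = 0].
Proof.
split; [split|] => /=; first exact: lie_morph0.
- by move=> a x y hx hy; rewrite lie_morphP hx hy scaler0 addr0.
- by move=> x y hy; rewrite lie_morph hy lie0r.
Qed.

Lemma free_to_arrE B : @free_to_arr B =1 lie_quot_pi arr_ideal \o @free_incl B.
Proof.
elim/free_lie_ind=> [x||a x y hx hy|x y hx hy] /=.
- by rewrite [LHS]free_lie_lift_gen /free_incl free_lie_lift_gen.
- by rewrite !lie_morph0.
- by rewrite !lie_morphP /= hx hy.
- by rewrite !lie_morph /= hx hy.
Qed.

Lemma free_to_arr0 B u : lie_ideal_set (loc_ideal B) u -> free_to_arr u = 0.
Proof.
move: u; apply: lie_ideal_gen_min; first exact: (ker_ideal (@free_to_arr B)).
move=> r hr /=; rewrite free_to_arrE; apply/lie_quot_pi_eq0.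
by apply: sub_lie_ideal_gen; right; exists B, r.
Qed.

Definition loc_s B : loc_lie B -> arr_lie := lie_quot_lift (@free_to_arr0 B).

HB.instance Definition _ B := LieMorphism.on (@loc_s B).

Lemma loc_s_gen B (x : block_elt B) : loc_s (loc_gen x) = arr_gen (val x).
Proof. by rewrite /loc_s lie_quot_lift_pi [LHS]free_lie_lift_gen. Qed.

(* loc_pi B is pi_B, induced on the quotient by free_to_loc B. *)
Definition free_to_loc B : free_lie C X -> loc_lie B :=
  free_lie_lift (fun x =>
    if insub x is Some x' then loc_gen (x' : block_elt B) else 0).

HB.instance Definition _ B := LieMorphism.on (free_to_loc B).

Lemma free_to_loc_in B (x : block_elt B) :
  free_to_loc B (free_lie_gen (val x)) = loc_gen x.
Proof. by rewrite [LHS]free_lie_lift_gen valK. Qed.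

Lemma free_to_loc_out B (x : X) :
  x \notin val B -> free_to_loc B (free_lie_gen x) = 0.
Proof. by move=> hx; rewrite [LHS]free_lie_lift_gen insubN. Qed.

Lemma free_to_loc0 B u : lie_ideal_set arr_ideal u -> free_to_loc B u = 0.
Proof.
move: u; apply: lie_ideal_gen_min; first exact: (ker_ideal (free_to_loc B)).
move=> u [[x [y [hxy ->]]]|[D [r hr ->]]] /=.
  rewrite lie_morph /=; have [hx|/free_to_loc_out->] := boolP (x \in val B); last first.
    by rewrite lie0l.
  have [hy|/free_to_loc_out->] := boolP (y \in val B); last by rewrite lie0r.
  by have := hxy _ (valP B); rewrite finset.subUset !finset.sub1set hx hy.
have [eDB|neDB] := eqVneq D B.
  case: B / eDB; suff -> : free_to_loc D (free_incl r) = lie_quot_pi (loc_ideal D) r.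
    by apply/lie_quot_pi_eq0; exact: sub_lie_ideal_gen.
  elim/free_lie_ind: {hr} r => [x||a x y hx hy|x y hx hy].
  - by rewrite /free_incl free_lie_lift_gen free_to_loc_in.
  - by rewrite !lie_morph0.
  - by rewrite !lie_morphP /= hx hy.
  - by rewrite !lie_morph /= hx hy.
have [g hg] : exists g : loc_lie B, forall v : free_lie C (block_elt D),
    exists a : C, free_to_loc B (free_incl v) = a *: g.
  have hcard : (#|val D :&: val B| <= 1)%N.
    by apply: (arr_block_meet (valP D) (valP B)); rewrite (inj_eq val_inj).
  have [g hg] : exists g : loc_lie B, forall x : block_elt D,
      exists a : C, free_to_loc B (free_lie_gen (val x)) = a *: g.
    have [e|[z hz]] := finset.set_0Vmem (val D :&: val B).
      exists 0 => x; exists 0; rewrite scaler0 free_to_loc_out //.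
      apply/negP=> hx; have := finset.in_set0 (val x).
      by rewrite -e finset.in_setI (valP x) hx.
    exists (free_to_loc B (free_lie_gen z)) => x.
    have [hx|/free_to_loc_out->] := boolP (val x \in val B); last first.
      by exists 0; rewrite scale0r.
    exists 1; rewrite scale1r; congr (free_to_loc B (free_lie_gen _)).
    by apply: (card_le1_eqP hcard) => //; rewrite finset.in_setI (valP x).
  exists g; elim/free_lie_ind=> [x||a v w [b hu] [c hv]|v w [b hu] [c hv]].
  - by rewrite /free_incl free_lie_lift_gen.
  - by exists 0; rewrite !lie_morph0 scale0r.
  - by exists (a * b + c); rewrite !lie_morphP /= hu hv scalerDl scalerA.
  - by exists 0; rewrite !lie_morph /= hu hv lieZl lieZr lie_alt !scaler0 scale0r.
suff: [set v : free_lie C (block_elt D) | free_to_loc B (free_incl v) = 0] r by [].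
apply: (relator_derived hr); split.
  split=> [|a x y /= hx hy] /=; first by rewrite !lie_morph0.
  by rewrite !lie_morphP /= hx hy scaler0 addr0.
move=> _ [v [w ->]] /=; rewrite !lie_morph /=.
have [a ->] := hg v; have [b ->] := hg w.
by rewrite lieZl lieZr lie_alt !scaler0.
Qed.

Definition loc_pi B : arr_lie -> loc_lie B := lie_quot_lift (@free_to_loc0 B).

HB.instance Definition _ B := LieMorphism.on (loc_pi B).

Lemma loc_pi_in B (x : block_elt B) : loc_pi B (arr_gen (val x)) = loc_gen x.
Proof. by rewrite /loc_pi lie_quot_lift_pi [LHS]free_to_loc_in. Qed.

Lemma loc_pi_out B (x : X) : x \notin val B -> loc_pi B (arr_gen x) = 0.
Proof. by move=> hx; rewrite /loc_pi lie_quot_lift_pi [LHS]free_to_loc_out. Qed.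

Definition loc_s' B : derived (loc_lie B) -> derived arr_lie :=
  derived_map (@loc_s B).

HB.instance Definition _ B := GRing.Linear.on (@loc_s' B).

Definition loc_pi' B : derived arr_lie -> derived (loc_lie B) :=
  derived_map (loc_pi B).

HB.instance Definition _ B := GRing.Linear.on (loc_pi' B).

Definition loc_derived_sum := direct_sum (fun B : block A => derived (loc_lie B)).

HB.instance Definition _ := GRing.Lmodule.on loc_derived_sum.

Definition arr_s' (u : loc_derived_sum) : derived arr_lie :=
  \sum_(B : block A) loc_s' (u B).

Lemma arr_s'_linear : linear arr_s'.
Proof.
move=> a u v; rewrite /arr_s' scaler_sumr -big_split /=.
by apply: eq_bigr => B _; rewrite direct_sum_linE linearP.
Qed.

HB.instance Definition _ := GRing.isLinear.Build C loc_derived_sum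
  (derived arr_lie) *:%R arr_s' arr_s'_linear.

Definition arr_pi' (z : derived arr_lie) : loc_derived_sum :=
  direct_sum_of (fun B => loc_pi' B z).

Lemma arr_pi'_linear : linear arr_pi'.
Proof.
by move=> a u v; apply/ffunP=> B; rewrite direct_sum_linE !ffunE linearP.
Qed.

HB.instance Definition _ := GRing.isLinear.Build C (derived arr_lie)
  loc_derived_sum *:%R arr_pi' arr_pi'_linear.

Definition im_s' B : set arr_lie := range (fun u => val (@loc_s' B u)).

Definition sum_im_s' : set arr_lie :=
  [set z | exists2 v : block A -> arr_lie,
    (forall B, im_s' B (v B)) & z = \sum_(B : block A) v B].

Definition replacement_condition : Prop :=
  forall (B : block A) (x : block_elt B), (3 <= #|val B|)%N ->
    (exists2 D : block A, D != B & val x \in val D) ->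
    @derived_set C (loc_lie B)
      `<=` lie_subalgebra_gen [set loc_gen y | y in [set y | y != x]].

Definition graded_by_positive_degrees : Prop :=
  exists deg : X -> nat,
    (forall x, (0 < deg x)%N) /\ homogeneous_ideal deg arr_ideal.

End ArrangementLie.

Arguments arr_gen {C X A} R x.
Arguments im_s' {C X A} R B _.
Arguments sum_im_s' {C X A} R _.
Arguments arr_s' {C X A R} u.
Arguments arr_pi' {C X A} R z.

(* Main.v *)
From mathcomp Require Import boolp classical_sets.
Require Import Defs.
From mathcomp Require Import all_boot all_algebra.

(* The composites pi_D o s_B are the identity for D = B and vanish on derived
   algebras for D <> B, so pi' o s' = id; this makes 3), 4) and 5) equivalent
   and 5) => 6) a matter of evaluating pi_D on [x, [y, z]].
   For 6) => 1), since s_B(L_B') is spanned by iterated brackets of generators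
   of B, it is enough to show that x outside B commutes with [a, u] when a is in
   B and u in s_B(L_B') is centralized by all generators outside B, that is,
   that [[x, a], u] = 0.  If x and a lie in a common block D, then B and D meet
   only in a.  If |D| >= 3, replacement in D writes [x, a] in the generators of
   D \ {a}, which centralize u; if |D| = 2, then |B| >= 3, and replacement in B
   writes u in the generators of B \ {a}, which centralize [x, a] by 6). *)

Set Implicit Arguments.
Unset Strict Implicit.
Unset Printing Implicit Defensive.

Import GRing.Theory.

Local Open Scope ring_scope.

(** * Ideals, derived algebras and centralizers tested on generators *)

Lemma lie_jacobi_derivation (C : comPzRingType) (L : lieAlgType C)
    (x y z : L) :
  [lie x, [lie y, z]] = [lie [lie x, y], z] + [lie y, [lie x, z]].
Proof.
have := lie_jacobi x y z; rewrite (lieC z x) lieNr (lieC z [lie x, y]) => /eqP.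
by rewrite subr_eq0 subr_eq addrC => /eqP ->; rewrite addrC.
Qed.

Section Subobjects.
Variables (C : comPzRingType) (L : lieAlgType C).
Implicit Types I G : set L.

Lemma submodule0 I : is_submodule I -> I 0.
Proof. by case. Qed.

Lemma submoduleD I x y : is_submodule I -> I x -> I y -> I (x + y).
Proof. by case=> _ h hx hy; rewrite -[x]scale1r; apply: h. Qed.

Lemma submoduleB I x y : is_submodule I -> I x -> I y -> I (x - y).
Proof.
by case=> _ h hx hy; rewrite addrC -scaleN1r; apply: h.
Qed.

Lemma lie_subalgebra_gen_ind G (P : L -> Prop) :
  is_submodule P -> (forall x, G x -> P x) ->
  (forall x y, P x -> P y -> P [lie x, y]) ->
  forall x, lie_subalgebra_gen G x -> P x.
Proof. by move=> hP hG hB x; apply. Qed.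

(** By the Jacobi identity, the elements [x] with [[x, I]] inside [I] form a Lie subalgebra, so it
    is enough that this subalgebra contains [G]. *)
Lemma ideal_from_generators G I :
  (forall x, lie_subalgebra_gen G x) -> is_submodule I ->
  (forall g u, G g -> I u -> I [lie g, u]) -> is_lie_ideal I.
Proof.
move=> hG hI hGI; split=> // x.
pose P x := forall u, I u -> I [lie x, u].
apply: (@lie_subalgebra_gen_ind G P _ _ _ x (hG x)) => //.
- split=> [u hu|a v w hv hw u hu]; first by rewrite lie0l; apply: submodule0.
  by rewrite lie_linearl; case: (hI) => _; apply; [apply: hv|apply: hw].
- by move=> g hg u hu; apply: hGI.
- move=> v w hv hw u hu.
  have -> : [lie [lie v, w], u] = [lie v, [lie w, u]] - [lie w, [lie v, u]].
    by rewrite (lie_jacobi_derivation v) addrK.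
  by apply: submoduleB => //; [apply/hv/hw|apply/hw/hv].
Qed.

(** An induction principle for the derived algebra. The first two closure conditions make [I] an
    ideal; then [[g, x]] lies in [I] for [g] in [G] by induction on [x], and finally [[x, y]] by
    induction on [x]. *)
Lemma derived_set_min G I :
  (forall x, lie_subalgebra_gen G x) -> is_submodule I ->
  (forall g u, G g -> I u -> I [lie g, u]) ->
  (forall g h, G g -> G h -> I [lie g, h]) ->
  forall u, derived_set u -> I u.
Proof.
move=> hG hI hGI hGG; have [_ hLI] := ideal_from_generators hG hI hGI.
have hIL x y : I x -> I [lie x, y].
  by move=> hx; rewrite lieC -sub0r; apply: submoduleB => //;
    [apply: submodule0|apply: hLI].
have hGL g x : G g -> I [lie g, x].
  move=> hg; apply: (@lie_subalgebra_gen_ind G (fun x => I [lie g, x]) _ _ _ x (hG x)).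
  - split=> [|a v w hv hw]; first by rewrite lie0r; apply: submodule0.
    by rewrite lie_linearr; case: (hI) => _; apply.
  - by move=> h hh; apply: hGG.
  - move=> v w hv hw; rewrite lie_jacobi_derivation.
    by apply: submoduleD => //; [apply: hIL|apply: hLI].
move=> u; apply; split=> // _ [x [y ->]].
apply: (@lie_subalgebra_gen_ind G (fun x => I [lie x, y]) _ _ _ x (hG x)).
- split=> [|a v w hv hw]; first by rewrite lie0l; apply: submodule0.
  by rewrite lie_linearl; case: (hI) => _; apply.
- by move=> g hg; apply: hGL.
- move=> v w hv hw; rewrite lieC lie_jacobi_derivation -sub0r.
  apply: submoduleB => //; first exact: submodule0.
  apply: submoduleD => //; last by apply: hLI; rewrite lieC -sub0r;
    apply: submoduleB => //; exact: submodule0.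
  by apply: hIL; rewrite lieC -sub0r; apply: submoduleB => //; exact: submodule0.
Qed.

(** The centralizer of [z] is a subalgebra. The morphism [f] is there to carry the replacement
    condition, which lives in a local algebra, over to [arr_lie R]. *)
Lemma subalgebra_gen_centralizes (M : lieAlgType C) (f : {liemorphism L -> M})
    G (z : M) :
  (forall g, G g -> [lie f g, z] = 0) ->
  forall x, lie_subalgebra_gen G x -> [lie f x, z] = 0.
Proof.
move=> hG; apply: lie_subalgebra_gen_ind => //.
- split=> [|a v w hv hw]; first by rewrite linear0 lie0l.
  by rewrite linearP lie_linearl hv hw scaler0 addr0.
- move=> v w hv hw; rewrite lie_morph lieC lie_jacobi_derivation.
  by rewrite (lieC z (f v)) (lieC z (f w)) hv hw !oppr0 lie0l lie0r addr0 oppr0.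
Qed.

End Subobjects.

Lemma free_quotient_gen (C : comPzRingType) (Y : Type)
    (I : lieIdeal (free_lie C Y)) (x : lie_quot I) :
  lie_subalgebra_gen (range (fun y => lie_quot_pi I (free_lie_gen y))) x.
Proof.
elim/lie_quot_ind: x; elim/free_lie_ind=> [y||a x y hx hy|x y hx hy] H hH.
- by case: hH => _; apply; exists y.
- by rewrite linear0; case: hH => -[[]].
- by rewrite linearP; case: (hH) => -[[_ h] _] _; apply: h; [apply: hx|apply: hy].
- by rewrite lie_morph; case: (hH) => -[_ h] _; apply: h; [apply: hx|apply: hy].
Qed.

(** * The composites of [loc_s] and [loc_pi] *)

Section ArrangementLie.
Variables (C : comPzRingType) (X : finType) (A : set_arrangement X).
Variable (R : relators C A).
Implicit Types B D : block A.

Lemma arr_lie_gen (u : arr_lie R) : lie_subalgebra_gen (range (arr_gen R)) u.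
Proof. exact: free_quotient_gen. Qed.

Lemma loc_lie_gen B (u : loc_lie R B) :
  lie_subalgebra_gen (range (@loc_gen C X A R B)) u.
Proof. exact: free_quotient_gen. Qed.

Lemma arr_gen_lie0 x y :
  (forall D, ~~ ((x \in val D) && (y \in val D))) ->
  [lie arr_gen R x, arr_gen R y] = 0.
Proof.
move=> h; rewrite /arr_gen -lie_quot_pi_morph; apply/lie_quot_pi_eq0.
apply: sub_lie_ideal_gen; left; exists x, y; split=> // D hD.
by rewrite finset.subUset !finset.sub1set (h (exist _ D hD)).
Qed.

Lemma block_meet_eq B D x y : B != D ->
  x \in val B -> x \in val D -> y \in val B -> y \in val D -> x = y.
Proof.
move=> neBD xB xD yB yD.
have hc : (#|val B :&: val D| <= 1)%N.
  by apply: (arr_block_meet (valP B) (valP D)); rewrite (inj_eq val_inj).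
by apply: (card_le1_eqP hc); rewrite finset.in_setI ?xB ?yB.
Qed.

Lemma loc_s_val B x (hx : x \in val B) :
  arr_gen R x = loc_s (loc_gen R (exist _ x hx : block_elt B)).
Proof. by rewrite loc_s_gen. Qed.

Lemma loc_sK B : cancel (@loc_s C X A R B) (loc_pi B).
Proof.
elim/lie_quot_ind; elim/free_lie_ind=> [y||a x y hx hy|x y hx hy].
- by rewrite (loc_s_gen R y) loc_pi_in.
- by rewrite !lie_morph0.
- by do 3 rewrite lie_morphP /=; rewrite hx hy.
- by do 3 rewrite lie_morph /=; rewrite hx hy.
Qed.

(** Distinct blocks share at most one point: of two generators of [B], either one lies outside [D]
    and is killed, or both are the common point and the bracket is alternating. *)
Lemma loc_pi_s_neq B D (u : loc_lie R B) : B != D ->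
  derived_set u -> loc_pi D (loc_s u) = 0.
Proof.
move=> neBD.
apply: (@derived_set_min _ _ _ (fun u => loc_pi D (loc_s u) = 0) (@loc_lie_gen B)).
- split=> [|a v w hv hw]; first by rewrite !lie_morph0.
  by do 2 rewrite lie_morphP /=; rewrite hv hw scaler0 addr0.
- by move=> g v _ hv; do 2 rewrite lie_morph /=; rewrite hv lie0r.
- move=> _ _ [x _ <-] [y _ <-]; do 2 rewrite lie_morph /=; rewrite !loc_s_gen.
  have [xD|xD] := boolP (val x \in val D); last by rewrite loc_pi_out // lie0l.
  have [yD|yD] := boolP (val y \in val D); last by rewrite (loc_pi_out _ yD) lie0r.
  by rewrite (block_meet_eq neBD (valP x) xD (valP y) yD) lie_alt.
Qed.

(** * Images of the derived local algebras, and the implications from 1) to 6) *)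

Lemma im_s'P B (z : arr_lie R) :
  im_s' R B z <-> exists2 u : loc_lie R B, derived_set u & z = loc_s u.
Proof.
split=> [[[u hu] _ <-]|[u /asboolP hu ->]]; first by exists u => //; apply/asboolP.
by exists (Derived hu).
Qed.

Lemma im_s'_submodule B : is_submodule (im_s' R B).
Proof.
have [h0 hl] := derived_set_submodule (loc_lie R B).
split; first by apply/im_s'P; exists 0; rewrite ?linear0.
move=> a x y /im_s'P[u hu ->] /im_s'P[v hv ->].
by apply/im_s'P; exists (a *: u + v); [apply: hl|rewrite linearP].
Qed.

Lemma im_s'_derived B z : im_s' R B z -> derived_set z.
Proof. by move=> /im_s'P[u hu ->]; apply: derived_set_morph. Qed.

Lemma val_arr_s' (u : loc_derived_sum R) :
  val (arr_s' u) = \sum_B loc_s (val (u B)).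
Proof. by rewrite /arr_s' raddf_sum. Qed.

Lemma arr_s'K : cancel (@arr_s' C X A R) (arr_pi' R).
Proof.
move=> u; apply/ffunP=> D; rewrite ffunE; apply: val_inj.
rewrite [LHS]/= [X in loc_pi D X]val_arr_s' linear_sum (bigD1 D) //= loc_sK big1 ?addr0 // => B neBD.
by apply: loc_pi_s_neq => //; apply/asboolP/derived_valP.
Qed.

Lemma im_s'_ideal :
  (forall B (x : X), x \notin val B ->
    forall u : arr_lie R, im_s' R B u -> [lie arr_gen R x, u] = 0) ->
  forall B, is_lie_ideal (im_s' R B).
Proof.
move=> h B; apply: (ideal_from_generators arr_lie_gen); first exact: im_s'_submodule.
(* A generator in [B] acts through [loc_s], and one outside [B] acts by zero. *)
move=> _ u [x _ <-] hu; have [xB|xB] := boolP (x \in val B).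
  have /im_s'P[v hv ->] := hu; apply/im_s'P.
  exists [lie loc_gen R (exist _ x xB : block_elt B), v]; first exact: lie_derived.
  by rewrite lie_morph /= loc_s_gen.
by rewrite (h B x xB u hu); apply: submodule0; apply: im_s'_submodule.
Qed.

Lemma sum_im_s'_submodule : is_submodule (sum_im_s' R).
Proof.
split.
  exists (fun=> 0) => [B|]; last by rewrite big1.
  exact: (submodule0 (im_s'_submodule _)).
move=> a _ _ [v hv ->] [w hw ->].
exists (fun B => a *: v B + w B) => [B|]; first by have [_] := im_s'_submodule B; apply.
by rewrite scaler_sumr -big_split.
Qed.

Lemma im_s'_sub_sum B z : im_s' R B z -> sum_im_s' R z.
Proof.
move=> hz; exists (fun D => if D == B then z else 0) => [D|].
  by case: eqP => [->//|_]; exact: (submodule0 (im_s'_submodule _)).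
by rewrite -big_mkcond big_pred1_eq.
Qed.

(** The sum of the images is stable under brackets with generators, and it contains every bracket of
    two generators: either they share a block and the bracket comes from its local algebra, or the
    bracket is a relator. *)
Lemma derived_arr_lie :
  (forall B, is_lie_ideal (im_s' R B)) ->
  derived_set (L := arr_lie R) = sum_im_s' R.
Proof.
move=> h; apply/seteqP; split=> u.
  apply: (derived_set_min arr_lie_gen); first exact: sum_im_s'_submodule.
  - move=> g _ _ [v hv ->]; exists (fun B => [lie g, v B]) => [B|].
      by have [_] := h B; apply.
    elim/big_rec2: _ => [|B x y _ <-]; first by rewrite lie0r.
    by rewrite lieDr.
  - move=> _ _ [x _ <-] [y _ <-].
    have [/existsP[B /andP[xB yB]]|] :=
      boolP [exists B : block A, (x \in val B) && (y \in val B)].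
      apply: (@im_s'_sub_sum B); rewrite (loc_s_val xB) (loc_s_val yB) -lie_morph.
      apply/im_s'P; exists [lie loc_gen R (exist _ x xB : block_elt B),
                                loc_gen R (exist _ y yB : block_elt B)] => //.
      exact: lie_derived.
    rewrite negb_exists => /forallP hxy; rewrite arr_gen_lie0 //.
    exact: (submodule0 sum_im_s'_submodule).
move=> [v hv ->]; elim/big_ind: _ => [|x y|B _]; last exact: im_s'_derived (hv B).
- exact: (submodule0 (derived_set_submodule _)).
- exact: (submoduleD (derived_set_submodule _)).
Qed.

Lemma arr_s'_surj :
  derived_set (L := arr_lie R) = sum_im_s' R ->
  forall z, exists u : loc_derived_sum R, arr_s' u = z.
Proof.
move=> h z; have : derived_set (val z) by apply/asboolP/derived_valP.
rewrite h => -[v hv hz].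
exists (direct_sum_of (fun B => sval (cid2 (hv B)))).
apply: val_inj; rewrite hz val_arr_s'; apply: eq_bigr => B _.
by rewrite ffunE; case: (cid2 (hv B)).
Qed.

Lemma arr_pi'_inj :
  (forall z, exists u : loc_derived_sum R, arr_s' u = z) ->
  injective (arr_pi' R).
Proof.
by move=> h z w; have [u <-] := h z; have [v <-] := h w; rewrite !arr_s'K => ->.
Qed.

Lemma gen_triple_lie0 :
  injective (arr_pi' R) ->
  forall B (x y z : X), x \notin val B -> y \in val B -> z \in val B ->
  [lie arr_gen R x, [lie arr_gen R y, arr_gen R z]] = 0.
Proof.
move=> inj B x y z xB yB zB.
have /asboolP hd := lie_derived (arr_gen R x) [lie arr_gen R y, arr_gen R z].
suff /inj /(congr1 val) : arr_pi' R (Derived hd) = arr_pi' R 0 by [].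
apply/ffunP=> D; rewrite !ffunE; apply: val_inj; rewrite /= lie_morph0; do 2 rewrite lie_morph /=.
(* Every projection kills the triple bracket: for [D = B] it kills [x]; otherwise it kills [y] or
   [z], or both are the single common point of [B] and [D]. *)
have [eBD|neBD] := eqVneq B D; first by rewrite -eBD loc_pi_out // lie0l.
have [yD|yD] := boolP (y \in val D); last by rewrite (loc_pi_out _ yD) lie0l lie0r.
have [zD|zD] := boolP (z \in val D); last by rewrite (loc_pi_out _ zD) !lie0r.
by rewrite (block_meet_eq neBD yB yD zB zD) lie_alt lie0r.
Qed.

(** * The implication from 6) to 1) *)

Section Replacement.
Hypothesis hrepl : replacement_condition R.
Hypothesis hdisj : forall B D, #|val B| = 2%N -> #|val D| = 2%N ->
  B != D -> [disjoint val B & val D].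
Hypothesis gen_lie0 : forall B (x y z : X),
  x \notin val B -> y \in val B -> z \in val B ->
  [lie arr_gen R x, [lie arr_gen R y, arr_gen R z]] = 0.

Lemma gen_bracket_centralizes B D (x a : X) (u : loc_lie R B) :
  B != D -> x \in val D -> a \in val D -> a \in val B -> derived_set u ->
  (forall y, y \notin val B -> [lie arr_gen R y, loc_s u] = 0) ->
  [lie [lie arr_gen R x, arr_gen R a], loc_s u] = 0.
Proof.
move=> neBD xD aD aB hu huC.
have [D3|] := leqP 3 #|val D|.
  (* Replacement in [D] may omit [a], since [a] also lies in [B]. The remaining generators of [D]
     are outside [B], so [huC] applies to them. *)
  have := @hrepl D (exist _ a aD) D3 (ex_intro2 _ _ B neBD aB).
  move/(_ _ (lie_derived (loc_gen R (exist _ x xD : block_elt D))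
                         (loc_gen R (exist _ a aD : block_elt D)))).
  rewrite (loc_s_val xD) (loc_s_val aD) -(lie_morph (@loc_s C X A R D)).
  apply: (subalgebra_gen_centralizes (f := @loc_s C X A R D)) => _ [y /= ya <-]; rewrite loc_s_gen.
  apply: huC; apply: contraNN ya => yB; rewrite -val_eqE /=.
  by rewrite (block_meet_eq neBD yB (valP y) aB aD).
rewrite ltnS => D2; have {}D2 : #|val D| = 2%N.
  by apply/eqP; rewrite eqn_leq D2 (arr_block_card (valP D)).
(* Two-element blocks are disjoint, but [B] and [D] share [a]. *)
have B3 : (3 <= #|val B|)%N.
  have := arr_block_card (valP B); rewrite leq_eqVlt => /predU1P[/esym B2|//].
  by have /pred0P/(_ a) := hdisj B2 D2 neBD; rewrite /= aB aD.
(* The roles are exchanged: [u] is now the element written in generators, those of [B] other than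
   [a]. They lie outside [D], so 6) for the block [D] makes them commute with [[x, a]]. *)
rewrite lieC; apply/eqP; rewrite oppr_eq0; apply/eqP.
have neDB : D != B by rewrite eq_sym.
move: u hu {huC} => u /(@hrepl B (exist _ a aB) B3 (ex_intro2 _ _ D neDB aD)).
apply: subalgebra_gen_centralizes => _ [y /= ya <-]; rewrite loc_s_gen.
apply: (gen_lie0 _ xD aD); apply: contraNN ya => yD; rewrite -val_eqE /=.
by rewrite (block_meet_eq neBD (valP y) yD aB aD).
Qed.

Lemma gen_centralizes_im_s' B (x : X) (u : arr_lie R) :
  x \notin val B -> im_s' R B u -> [lie arr_gen R x, u] = 0.
Proof.
move=> xB /im_s'P[{}u hu ->].
(* The invariant keeps [derived_set u], needed for replacement in [B], and ranges over all [y]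
   outside [B], because replacement in [D] brings in generators other than the given [x]. *)
pose I (u : loc_lie R B) := derived_set u /\
  forall y, y \notin val B -> [lie arr_gen R y, loc_s u] = 0.
suff [_] : I u by apply.
have [d0 dl] := derived_set_submodule (loc_lie R B).
apply: (derived_set_min (@loc_lie_gen B)) hu.
- split=> [|a v w [dv hv] [dw hw]].
    by split=> // y _; rewrite linear0 lie0r.
  split=> [|y hy]; first exact: dl.
  by rewrite linearP lie_linearr hv // hw // scaler0 addr0.
- move=> _ v [a _ <-] [dv hv]; split=> [|y yB]; first exact: lie_derived.
  (* As [y] centralizes [loc_s v], Jacobi leaves only [[[y, a], loc_s v]], whose inner bracket is a
     relator unless [y] and [a] share a block. *)
  rewrite lie_morph /= loc_s_gen lie_jacobi_derivation hv // lie0r addr0.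
  have [/existsP[D /andP[yD aD]]|] :=
    boolP [exists D : block A, (y \in val D) && (val a \in val D)].
    apply: (gen_bracket_centralizes _ yD aD (valP a)) => //.
    by apply: contraNneq yB => ->.
  by rewrite negb_exists => /forallP hya; rewrite arr_gen_lie0 // lie0l.
- move=> _ _ [a _ <-] [b _ <-]; split=> [|y yB]; first exact: lie_derived.
  by rewrite lie_morph /= !loc_s_gen (gen_lie0 yB (valP a) (valP b)).
Qed.

End Replacement.

End ArrangementLie.

Theorem theorem2p9 (C : comPzRingType) (X : finType) (A : set_arrangement X)
    (R : relators C A)
    (hrepl : replacement_condition R)
    (hdisj : forall B D : block A, #|val B| = 2%N -> #|val D| = 2%N ->
      B != D -> [disjoint val B & val D])
    (hgr : graded_by_positive_degrees R \/
      forall B D E : block A,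
        #|val D| = 2%N -> val B :&: val D != set0 ->
        #|val E| = 2%N -> val B :&: val E != set0 -> D = E) :
  [<-> forall (B : block A) (x : X), x \notin val B ->
         forall u : arr_lie R, im_s' R B u -> [lie arr_gen R x, u] = 0;
       forall B : block A, is_lie_ideal (im_s' R B);
       derived_set (L := arr_lie R) = sum_im_s' R;
       forall z : derived (arr_lie R), exists u : loc_derived_sum R,
         arr_s' u = z;
       injective (arr_pi' R);
       forall (B : block A) (x y z : X),
         x \notin val B -> y \in val B -> z \in val B ->
         [lie arr_gen R x, [lie arr_gen R y, arr_gen R z]] = 0 ].
Proof.
tfae.
- exact: im_s'_ideal.
- exact: derived_arr_lie.
- exact: arr_s'_surj.
- exact: arr_pi'_inj.
- exact: gen_triple_lie0.
- by move=> gen_lie0 B x xB u; apply: gen_centralizes_im_s'.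
Qed.
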